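(* For a Tychonoff space $X$ the following are equivalent: (i) $C_p(X)$ is a quasi-$(DF)$-space; (ii) $C_p(X)$ has a fundamental bounded resolution; (iii) $X$ is countable; (iv) $C_p(X)$ belongs to the class $\mathfrak{G}$; (v) $C_p(X)$ has a $\mathfrak{G}$-base.
   Context: $C_p(X)$ is the space of continuous real-valued functions on $X$ with the pointwise topology. Order $\mathbb{N}^{\mathbb{N}}$ pointwise. A resolution is a family $\{A_\alpha:\alpha\in\mathbb{N}^{\mathbb{N}}\}$ covering a set with $A_\alpha\subseteq A_\beta$ whenever $\alpha\le\beta$. A locally convex space $E$ has a fundamental bounded resolution if it has a resolution of bounded sets such that every bounded subset lies in some member. $E$ belongs to the class $\mathfrak{G}$ if there is a resolution of $(E',\sigma(E',E))$ such that every sequence in each member is equicontinuous. $E$ is a quasi-$(DF)$-space if it has a fundamental bounded resolution and belongs to $\mathfrak{G}$. A $\mathfrak{G}$-base is a base of neighbourhoods of zero $\{U_\alpha:\alpha\in\mathbb{N}^{\mathbb{N}}\}$ with $U_\alpha\subseteq U_\beta$ whenever $\beta\le\alpha$. *)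

(* Defs.v *)
From HB Require Import structures.
From mathcomp Require Import all_boot all_order all_algebra.
From mathcomp Require Import all_classical all_reals all_analysis.
Set Implicit Arguments. Unset Strict Implicit. Unset Printing Implicit Defensive.
Import Order.TTheory GRing.Theory Num.Theory numFieldNormedType.Exports.
Local Open Scope classical_set_scope.
Local Open Scope ring_scope.

Definition tychonoff_sp (R : realType) (X : topologicalType) : Prop :=
  accessible_space X /\
  forall (a : X) (B : set X), closed B -> ~ B a ->
    exists f : X -> R, [/\ continuous f, f a = 0,
      (forall x, 0 <= f x <= 1) & (forall b, B b -> f b = 1)].

Definition Cp (R : realType) (X : topologicalType) : set (X -> R) :=
  [set f | continuous f].

(** Neighbourhoods of g in C_p(X) for the pointwise topology (the subspace
    topology of the product R^X): subsets of C_p(X) containing a basic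
    set {f in C_p(X) | |f x - g x| < e for all x in F}, F finite, e > 0. *)
Definition cp_nbhs (R : realType) (X : topologicalType) (g : X -> R)
    (V : set (X -> R)) : Prop :=
  V `<=` @Cp R X /\
  exists (F : set X) (e : R), [/\ finite_set F, 0 < e &
    [set f | @Cp R X f /\ forall x, F x -> `|f x - g x| < e] `<=` V].

Definition cp_nbhs0 (R : realType) (X : topologicalType) (V : set (X -> R)) :=
  cp_nbhs (fun _ => 0) V.

Definition cp_bounded (R : realType) (X : topologicalType) (B : set (X -> R)) :=
  B `<=` @Cp R X /\
  forall V, cp_nbhs0 V -> exists r : R, 0 < r /\
    forall s : R, r <= s -> forall f, B f -> V (fun x => s^-1 * f x).

Definition le_nn (a b : nat -> nat) : Prop := forall n, (a n <= b n)%N.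

(** Elements of the dual C_p(X)': continuous linear functionals
    (represented by their action on C_p(X); values outside C_p(X) are
    irrelevant). *)
Definition cp_dual (R : realType) (X : topologicalType)
    (phi : (X -> R) -> R) : Prop :=
  (forall (a : R) (f g : X -> R), @Cp R X f -> @Cp R X g ->
     phi (fun x => a * f x + g x) = a * phi f + phi g) /\
  (forall g, @Cp R X g -> forall e : R, 0 < e ->
     exists V, cp_nbhs g V /\ forall f, V f -> `|phi f - phi g| < e).

Definition cp_equicontinuous (R : realType) (X : topologicalType)
    (H : set ((X -> R) -> R)) : Prop :=
  forall e : R, 0 < e -> exists V, cp_nbhs0 V /\
    forall phi f, H phi -> V f -> `|phi f| < e.

Definition cp_fund_bounded_resolution (R : realType) (X : topologicalType) :=
  exists B : (nat -> nat) -> set (X -> R),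
    [/\ (forall a, cp_bounded (B a)),
        (forall a b, le_nn a b -> B a `<=` B b),
        (forall f, @Cp R X f -> exists a, B a f) &
        (forall D, cp_bounded D -> exists a, D `<=` B a)].

Definition cp_class_G (R : realType) (X : topologicalType) :=
  exists A : (nat -> nat) -> set ((X -> R) -> R),
    [/\ (forall a, A a `<=` @cp_dual R X),
        (forall a b, le_nn a b -> A a `<=` A b),
        (forall phi, cp_dual phi -> exists a, A a phi) &
        (forall a (s : nat -> (X -> R) -> R), (forall n, A a (s n)) ->
           cp_equicontinuous (range s))].

Definition cp_quasiDF (R : realType) (X : topologicalType) :=
  cp_fund_bounded_resolution R X /\ cp_class_G R X.

Definition cp_G_base (R : realType) (X : topologicalType) :=
  exists U : (nat -> nat) -> set (X -> R),
    [/\ (forall a, cp_nbhs0 (U a)),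
        (forall V, cp_nbhs0 V -> exists a, U a `<=` V) &
        (forall a b, le_nn b a -> U a `<=` U b)].

(* Main.v *)
(** The implication from a fundamental bounded resolution [B] to countability
    is the deep one. For a finite sequence [s] let [Z s] be the set of points at
    which all members of all [B a], [a] extending [s], are bounded by the length
    of [s]. For each [a], the sets [Z (a|n)] cover [X]: otherwise a supremum of
    countably many indices yields a member of the resolution that is unbounded at
    some point. If [X] is uncountable, then either some [Z s] has uncountably many
    isolated points (take the cofinite filter on them), or some [p] is isolated in
    no [Z s] (take the punctured neighbourhoods of [p]). In both cases every
    branch [a] has some [Z (a|n)] meeting all members of the filter. One then picks
    x_k in the k-th set [Z s] outside the supports of finitely many earlier bump
    functions, and builds a pointwise bounded sequence f_k with
    f_k(x_k) > length of [s], which no [B a] can contain.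

    In class G, equicontinuity of sequences forces {x | delta_x in A a} to be
    finite, and the same supremum argument shows that a space with a resolution
    by finite sets is countable. *)

Require Import Defs.
From mathcomp Require Import all_boot all_order all_algebra.
From mathcomp Require Import all_classical all_reals all_analysis.

Set Implicit Arguments. Unset Strict Implicit. Unset Printing Implicit Defensive.
Import Order.TTheory GRing.Theory Num.Theory numFieldNormedType.Exports.
Local Open Scope classical_set_scope.
Local Open Scope ring_scope.

(** * Domination in N^N and selection along filters *)

Lemma finite_set_nat_bound (T : Type) (F : set T) (h : T -> nat) :
  finite_set F -> exists N, forall x, F x -> (h x <= N)%N.
Proof.
move=> /(finite_image h) /finite_seqP [s hs].
exists (\max_(i <- s) i)%N => x Fx.
have : (h @` F) (h x) by exists x.
by rewrite hs /= => hxs; exact: (leq_bigmax_seq (F := id)).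
Qed.

(** At coordinate [k] every [b n] with [n > k] agrees with [a], so only finitely many values have to
    be dominated there. *)
Lemma le_nn_sup (a : nat -> nat) (b : nat -> nat -> nat) :
  (forall n, mkseq (b n) n = mkseq a n) -> exists c, forall n, le_nn (b n) c.
Proof.
move=> ba; exists (fun k => \max_(n < k.+1) b n k + a k)%N => n k.
have [kn|nk] := ltnP k n.
  by rewrite -(nth_mkseq 0%N (b n) kn) ba nth_mkseq// leq_addl.
apply: leq_trans (leq_addr _ _).
have nk1 : (n < k.+1)%N by [].
exact: (leq_bigmax (F := fun i : 'I_k.+1 => b i k) (Ordinal nk1)).
Qed.

(** Recursive choice: [G k] is a member of [F] inside [A] and inside [N] of all earlier points, and
    [x k] is taken from [G k], within [Z k] whenever [Z k] meets every member of [F]. *)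
Lemma filter_selection (T : Type) (F : set_system T) (A : set T)
    (N : T -> set T) (Z : nat -> set T) :
  ProperFilter F -> F A -> (forall x, A x -> F (N x)) ->
  exists x : nat -> T, [/\ forall k, A (x k),
    forall j k, (j < k)%N -> N (x j) (x k) &
    forall k, (forall G, F G -> Z k `&` G !=set0) -> Z k (x k)].
Proof.
move=> PF FA FN; have [t0 _] := filter_ex FA.
have /choice [pt ptP] : forall kG : nat * set T, exists t, F kG.2 ->
    kG.2 t /\ ((forall G, F G -> Z kG.1 `&` G !=set0) -> Z kG.1 t).
  move=> [k G] /=; have [FG|nFG] := pselect (F G); last by exists t0.
  have [ZF|nZF] := pselect (forall G, F G -> Z k `&` G !=set0).
    by have [t [Zt Gt]] := ZF _ FG; exists t.
  by have [t Gt] := filter_ex FG; exists t.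
pose G := fix G k := if k is k'.+1 then G k' `&` N (pt (k', G k')) else A.
have GP k : F (G k) /\ G k `<=` A.
  elim: k => [|k [FG GA]] /=; first by split.
  split; last by move=> x [/GA].
  by apply: filterI => //; apply: FN; apply: GA; have [] := ptP (k, G k) FG.
have GS j k : (j < k)%N -> G k `<=` N (pt (j, G j)).
  elim: k => // k IH; rewrite ltnS leq_eqVlt => /orP[/eqP ->|/IH jk] x [] //.
  by move=> /jk.
have xG k : G k (pt (k, G k)) by have [] := ptP (k, G k) (GP k).1.
exists (fun k => pt (k, G k)); split => [k|j k jk|k].
- exact: (GP k).2.
- exact: GS (xG k).
- by have [] := ptP (k, G k) (GP k).1.
Qed.

Lemma cofinite_proper_filter (T : Type) (I : set T) :
  infinite_set I -> ProperFilter [set G : set T | finite_set (I `\` G)].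
Proof.
move=> Iinf; split.
  by rewrite /= setD0.
split => /=.
- by rewrite setDT; exact: finite_set0.
- move=> P Q fP fQ; change (finite_set (I `\` (P `&` Q))).
  by rewrite setDIr finite_setU.
- by move=> P Q PQ; apply: sub_finite_set => x [Ix nQ]; split=> // /PQ.
Qed.

Lemma countable_finite_resolution (T : Type) (K : (nat -> nat) -> set T) :
  (forall a, finite_set (K a)) -> (forall a b, le_nn a b -> K a `<=` K b) ->
  (forall x, exists a, K a x) -> countable [set: T].
Proof.
move=> Kfin Kmono Kcov.
(* [C s] is the union of the [K b] over all [b] extending [s]. Some finite [C (mkseq a n)] exists on
   every branch [a], and there are only countably many [s]. *)
pose C (s : seq nat) := [set x | exists2 b, mkseq b (size s) = s & K b x].
have Cfin a : exists n, finite_set (C (mkseq a n)).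
  apply: contrapT => /forallNP Cinf.
  have Tinf : infinite_set [set: T].
    by move=> /(sub_finite_set (@subsetT _ (C (mkseq a 0)))); exact: Cinf.
  have cof1 (x : T) : finite_set ([set: T] `\` ~` [set x]).
    by rewrite setDE setCK setTI; exact: finite_set1.
  have PF := cofinite_proper_filter Tinf.
  (* An infinite set meets every cofinite set, and removing each chosen point makes the [x n]
     distinct; a common bound [c] of the [b n] then makes [K c] infinite. *)
  have [x [_ xN xC]] := filter_selection (fun n => C (mkseq a n)) PF
    filterT (fun x _ => cof1 x).
  have {}xC n : C (mkseq a n) (x n).
    apply: xC => G Gfin; apply/set0P/negP => /eqP CG0; apply: (Cinf n).
    apply: sub_finite_set Gfin => y Cy; split=> // Gy.
    by have : (C (mkseq a n) `&` G) y by []; rewrite CG0.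
  have /choice [b bP] : forall n, exists b, mkseq b n = mkseq a n /\ K b (x n).
    by move=> n; have [b] := xC n; rewrite size_mkseq => ? ?; exists b.
  have [c bc] := le_nn_sup (fun n => (bP n).1).
  have xinj : injective x.
    have xlt i j : (i < j)%N -> x j <> x i by exact: xN.
    by move=> i j xij; case: (ltngtP i j) => // /xlt; rewrite xij.
  apply: infinite_nat; apply: (@sub_finite_set _ _ (x @^-1` K c)).
    by move=> n _ /=; apply: Kmono (bc n) _ (bP n).2.
  by apply: finite_preimage => // i j _ _; exact: xinj.
apply: (@sub_countable _ _ _ (\bigcup_(s in [set s | finite_set (C s)]) C s)).
  apply: subset_card_le => x _; have [a Kax] := Kcov x; have [n Cn] := Cfin a.
  by exists (mkseq a n) => //; exists a; rewrite ?size_mkseq.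
by apply: bigcup_countable => [|s]; [exact: countableP|exact: finite_set_countable].
Qed.

(** * Bounded sets of C_p(X) are the pointwise bounded ones *)

Lemma continuous_mull (R : realType) (X : topologicalType) (a : R) (f : X -> R) :
  continuous f -> continuous (fun x => a * f x).
Proof.
move=> cf x; apply: (continuousM (s := fun=> a)); last exact: cf.
exact: cvg_cst.
Qed.

Lemma cp_boundedP (R : realType) (X : topologicalType) (B : set (X -> R)) :
  B `<=` @Cp R X ->
  cp_bounded B <-> forall x, exists m : nat, forall f, B f -> `|f x| <= m%:R.
Proof.
move=> BC; split=> [[_ Bbd] x|/choice [h hP]].
  have [r [r0 rB]] : exists r : R, 0 < r /\ forall s, r <= s -> forall f, B f ->
      [set f | @Cp R X f /\ `|f x| < 1] (fun x => s^-1 * f x).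
    apply: Bbd; split; first by move=> f [].
    exists [set x], 1; split=> //.
    by move=> f [Cf /(_ x erefl)]; rewrite subr0.
  exists (Num.truncn r).+1 => f /(rB r (lexx r)) [_].
  rewrite normrM gtr0_norm ?invr_gt0// mulrC ltr_pdivrMr// mul1r => fr.
  exact/ltW/(lt_trans fr)/truncnS_gt.
split=> // V [_ [F [e [Ffin e0 FV]]]].
have [N FN] := finite_set_nat_bound h Ffin.
(* [N.+1] instead of [N] keeps the radius positive and the final inequality strict. *)
exists (N.+1%:R / e); split; first by rewrite divr_gt0.
move=> s Ns f Bf; have s0 : 0 < s by apply: lt_le_trans Ns; rewrite divr_gt0.
apply: FV; split=> [|x Fx].
  exact: continuous_mull (BC _ Bf).
rewrite subr0 normrM gtr0_norm ?invr_gt0// mulrC ltr_pdivrMr//.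
move: Ns; rewrite ler_pdivrMr// mulrC; apply: lt_le_trans.
by apply: le_lt_trans (hP _ _ Bf) _; rewrite ltr_nat ltnS FN.
Qed.

(** * From a fundamental bounded resolution to countability *)

(** Taking the length of [s] as the bound leaves countably many sets, with bounds tending to
    infinity along each branch. *)
Definition branch_bound (R : realType) (X : topologicalType)
    (B : (nat -> nat) -> set (X -> R)) (s : seq nat) : set X :=
  [set x | forall a, mkseq a (size s) = s ->
     forall f, B a f -> `|f x| <= (size s)%:R].

Lemma branch_bound_cover (R : realType) (X : topologicalType)
    (B : (nat -> nat) -> set (X -> R)) (a : nat -> nat) (x : X) :
  (forall a, cp_bounded (B a)) -> (forall a b, le_nn a b -> B a `<=` B b) ->
  exists n, branch_bound B (mkseq a n) x.
Proof.
move=> Bbd Bmono; apply: contrapT => /forallNP H.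
have /choice [bf bfP] : forall n, exists bf : (nat -> nat) * (X -> R),
    [/\ mkseq bf.1 n = mkseq a n, B bf.1 bf.2 & n%:R < `|bf.2 x|].
  move=> n; apply: contrapT => /forallNP nH; apply: (H n) => b.
  rewrite size_mkseq => ban f Bf; rewrite leNgt; apply/negP => nf.
  by apply: (nH (b, f)).
have [c cP] : exists c, forall n, le_nn (bf n).1 c.
  by apply: (le_nn_sup (a := a)) => n; have [] := bfP n.
have [m mP] := (cp_boundedP (Bbd c).1).1 (Bbd c) x.
have [_ Bm /lt_geF] := bfP m.
by rewrite mP //; apply: Bmono (cP m) _ Bm.
Qed.

Lemma continuous_sum_ord (R : realType) (X : topologicalType)
    (g : nat -> X -> R) (k : nat) :
  (forall j, continuous (g j)) -> continuous (fun y => \sum_(j < k) g j y).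
Proof.
move=> cg; elim: k => [|k IH] y.
  by under eq_fun do rewrite big_ord0; exact: cvg_cst.
by under eq_fun do rewrite big_ord_recr; apply: continuousD; [exact: IH|exact: cg].
Qed.

(** Diagonalization over all finite sequences, coded by [pickle]: each [g] is a bump at [x] that
    vanishes on a member of [F], so later points can avoid the supports of earlier bumps. *)
Lemma fund_bounded_resolution_filter (R : realType) (X : topologicalType)
    (B : (nat -> nat) -> set (X -> R)) (F : set_system X) (A : set X) :
  (forall D, cp_bounded D -> exists a, D `<=` B a) ->
  ProperFilter F -> F A ->
  (forall x, A x -> exists g : X -> R, [/\ continuous g,
     forall y, 0 <= g y <= 1, g x = 1 & F [set y | g y = 0]]) ->
  ~ forall a, exists n, forall G, F G -> branch_bound B (mkseq a n) `&` G !=set0.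
Proof.
move=> Bcof PF FA Ag HB.
have /choice [g gP] : forall x, exists g : X -> R, A x -> [/\ continuous g,
     forall y, 0 <= g y <= 1, g x = 1 & F [set y | g y = 0]].
  move=> x; have [/Ag [g gP]|nAx] := pselect (A x); first by exists g.
  by exists (fun _ => 0).
have gF x : A x -> F [set y | g x y = 0] by move=> /gP [].
have [x [xA xN xZ]] := filter_selection
  (fun k => if unpickle k is Some s then branch_bound B s else set0)
  PF FA gF.
(* One more than the bound that [branch_bound] imposes for the sequence coded by [k]; a non-code is
   read as the empty sequence. *)
pose c k : R := (size (odflt [::] (unpickle k : option (seq nat)))).+1%:R.
(* If g_j(y) > 0 then f_k(y) = 0 as soon as k > j and k g_j(y) >= 1, so the
   f_k are pointwise bounded whatever the constants c_k. *)
pose f k y := c k * Num.max 0 (g (x k) y - k%:R * \sum_(j < k) g (x j) y).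
have gc k : continuous (g (x k)) by have [] := gP _ (xA k).
have g01 k y : 0 <= g (x k) y <= 1 by have [] := gP _ (xA k).
have fC k : continuous (f k).
  apply: continuous_mull => y.
  apply: (@continuous_max R X (fun=> 0)); first exact: cvg_cst.
  apply: (@continuousB _ _ _ (g (x k))); first exact: gc.
  exact: continuous_mull (continuous_sum_ord gc) y.
have fxk k : f k (x k) = c k.
  rewrite /f big1 ?mulr0 ?subr0.
    by have [_ _ -> _] := gP _ (xA k); rewrite max_r ?mulr1.
  by move=> j _; exact: xN.
have frange : range f `<=` @Cp R X by move=> _ [k _ <-].
have [|a Ba] := Bcof (range f).
  apply/(cp_boundedP frange) => y.
  have [K KP] : exists K, forall k, (K <= k)%N -> f k y = 0.
    have [[j gj0]|nj] := pselect (exists j, 0 < g (x j) y); last first.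
      have g0 k : g (x k) y = 0.
        apply/eqP; rewrite eq_le (andP (g01 k y)).1 andbT leNgt.
        by apply/negP => ?; apply: nj; exists k.
      by exists 0%N => k _; rewrite /f g0 big1 ?mulr0 ?subr0 ?maxxx ?mulr0.
    exists (maxn j.+1 (Num.truncn (g (x j) y)^-1).+1) => k.
    rewrite geq_max => /andP[jk gk].
    rewrite /f max_l ?mulr0// subr_le0.
    apply: le_trans (andP (g01 k y)).2 _.
    apply: (@le_trans _ _ (k%:R * g (x j) y)).
      rewrite -ler_pdivrMr// mul1r; apply/ltW/(lt_le_trans (truncnS_gt _)).
      by rewrite ler_nat.
    rewrite ler_wpM2l// (bigD1 (Ordinal jk))//= lerDl sumr_ge0// => i _.
    by have /andP[] := g01 i y.
  have [M MP] := finite_set_nat_bound (fun k => (Num.truncn `|f k y|).+1)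
    (finite_II K).
  exists M => _ [k _ <-]; have [kK|/KP ->] := ltnP k K.
    apply/ltW/(lt_le_trans (truncnS_gt _)); rewrite ler_nat; exact: MP.
  by rewrite normr0.
(* For the code [k] of [mkseq a n], the point [x k] was selected in the branch set, which bounds
   [f k (x k)] by [n], although this value is [n + 1]. *)
have [n nP] := HB a; pose k := pickle (mkseq a n).
have Bfk : B a (f k) by apply: Ba; exists k.
have : branch_bound B (mkseq a n) (x k) by have := xZ k; rewrite /k pickleK; apply.
move=> /(_ a); rewrite size_mkseq => /(_ erefl _ Bfk).
by rewrite fxk /c /k pickleK /= size_mkseq normr_nat ler_nat ltnn.
Qed.

(** Vanishing near [B], not merely on it, puts the zero set into the punctured neighbourhood filter
    of each point of [B]. *)
Lemma tychonoff_separation (R : realType) (X : topologicalType)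
    (a : X) (B : set X) :
  tychonoff_sp R X -> closed B -> ~ B a ->
  exists g : X -> R, [/\ continuous g, forall y, 0 <= g y <= 1, g a = 1 &
    forall b, B b -> nbhs b [set y | g y = 0]].
Proof.
move=> [_ tX] cB nBa; have [f [cf fa f01 fB]] := tX a B cB nBa.
(* This truncation is zero wherever [f] exceeds 1/2, hence around each point where [f] is 1. *)
exists (fun y => Num.max 0 (1 - 2 * f y)); split.
- move=> y; apply: (@continuous_max R X (fun=> 0)); first exact: cvg_cst.
  apply: (continuousB (f := fun=> 1 : R) (g := fun y => 2 * f y)); first exact: cvg_cst.
  exact: continuous_mull.
- move=> y; rewrite le_max lexx ge_max ler01/= gerBl mulr_ge0//.
  by have /andP[] := f01 y.
- by rewrite fa mulr0 subr0 max_r.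
- move=> b Bb; have : \forall y \near b, 2^-1 < f y.
    apply: (cvgr_gt (f b)); first exact: cf.
    by rewrite fB// invf_lt1// ltr1n.
  apply: filterS => y /= fy; rewrite max_l// subr_le0.
  by rewrite mulrC -ler_pdivrMr// mul1r ltW.
Qed.

Lemma fund_bounded_resolution_countable (R : realType) (X : topologicalType) :
  tychonoff_sp R X -> cp_fund_bounded_resolution R X -> countable [set: X].
Proof.
move=> tX [B [Bbd Bmono _ Bcof]].
have clX : forall x : X, closed [set x] by exact: accessible_closed_set1 tX.1.
pose Z := branch_bound B.
(* [I s] is the set of isolated points of the subspace [Z s]. *)
pose I s := [set x | Z s x /\ exists2 U, nbhs x U & U `&` Z s `<=` [set x]].
have [Icount|/existsNP [s Iunc]] := pselect (forall s, countable (I s)).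
  apply: contrapT => Xunc.
  have [p pI] : exists p, forall s, ~ I s p.
    apply: contrapT => /forallNP nI; apply: Xunc.
    apply: (@sub_countable _ _ _ (\bigcup_s I s)).
      by apply: subset_card_le => p _; have /existsNP [s /contrapT] := nI p; exists s.
    by apply: bigcup_countable => // s _; exact: countableP.
  have meetZ s U : Z s p -> nbhs p U -> exists y, [/\ Z s y, U y & y != p].
    move=> Zp Up; apply: contrapT => /forallNP nU; apply: (pI s); split=> //.
    exists U => // y [Uy Zy]; apply/eqP/negPn/negP => yp.
    by apply: (nU y).
  have PF : ProperFilter p^'.
    split; last exact: dnbhs_filter.
    (* Properness of the filter says that [p] is not isolated in X: [p] lies in some [Z s] without
       being isolated there, and any branch provides such an [s]. *)
    move=> p0; have [n Zp] := branch_bound_cover (fun=> 0%N) p Bbd Bmono.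
    by have [y [_ + yp]] := meetZ _ _ Zp p0; exact.
  apply: (fund_bounded_resolution_filter (A := ~` [set p]) Bcof PF).
  - by near=> y; apply/eqP; near: y; exact: nbhs_dnbhs_neq.
  - move=> x xp; have [g [cg g01 gx gp]] := tychonoff_separation tX (clX p) xp.
    by exists g; split=> //; apply: nbhs_dnbhs; exact: gp.
  - move=> a; have [n Zp] := branch_bound_cover a p Bbd Bmono.
    by exists n => G Gp; have [y [Zy /= Gy yp]] := meetZ _ _ Zp Gp; exists y; split=> //; exact: Gy.
exfalso.
have PF : ProperFilter [set G : set X | finite_set (I s `\` G)].
  by apply: cofinite_proper_filter => /finite_set_countable.
apply: (fund_bounded_resolution_filter (A := I s) Bcof PF).
- by rewrite /= setDv; exact: finite_set0.
- move=> x [Zx [U Ux UZ]].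
  have cU : closed (~` U^°) by apply: open_closedC; exact: open_interior.
  have [g [cg g01 gx gU]] := tychonoff_separation tX cU (fun nUx => nUx Ux).
  exists g; split=> //=; apply: (@sub_finite_set _ _ [set x]) => //.
  (* [g] vanishes off the interior of [U], and [U] meets [Z s] at most in [x], so [x] is the only
     point of [I s] where [g] can be nonzero. *)
  move=> y [[Zy _] gy]; apply: UZ; split=> //.
  apply: contrapT => nUy; apply: gy; apply: (nbhs_singleton (gU y _)).
  by move=> /interior_subset.
(* Otherwise each [Z (mkseq a n)] would meet [I s] in a finite set; these sets cover [I s], which
   would be countable. *)
- move=> a; apply: contrapT => /forallNP nH; apply: Iunc.
  apply: (@sub_countable _ _ _ (\bigcup_n (I s `&` Z (mkseq a n)))).
    apply: subset_card_le => x Ix.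
    by have [n Zx] := branch_bound_cover a x Bbd Bmono; exists n.
  apply: bigcup_countable => [|n _]; first exact: countableP.
  apply: finite_set_countable; apply: contrapT => IZinf; apply: (nH n) => G Gfin.
  apply/set0P/negP => /eqP ZG0; apply: IZinf.
  apply: sub_finite_set Gfin => y [Iy Zy]; split=> // Gy.
  by have : (Z (mkseq a n) `&` G) y by []; rewrite ZG0.
Unshelve. all: by end_near. Qed.

(** * The dual of C_p(X) and the class G *)

Lemma cp_zero (R : realType) (X : topologicalType) : @Cp R X (fun=> 0).
Proof. by move=> x; exact: cvg_cst. Qed.

Lemma cp_dual0 (R : realType) (X : topologicalType) (phi : (X -> R) -> R) :
  cp_dual phi -> phi (fun=> 0) = 0.
Proof.
move=> [lphi _]; have := lphi 1 _ _ (@cp_zero R X) (@cp_zero R X).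
rewrite (_ : (fun x : X => 1 * 0 + 0 : R) = fun=> 0); last first.
  by apply/funext => x; rewrite mul1r addr0.
by move=> /eqP; rewrite mul1r -subr_eq0 opprD addNKr oppr_eq0 => /eqP.
Qed.

Lemma cp_dualZ (R : realType) (X : topologicalType) (phi : (X -> R) -> R)
    (a : R) (f : X -> R) :
  cp_dual phi -> @Cp R X f -> phi (fun x => a * f x) = a * phi f.
Proof.
move=> dphi Cf; have := dphi.1 a f _ Cf (@cp_zero R X).
by rewrite cp_dual0// addr0 => <-; congr phi; apply/funext => x; rewrite addr0.
Qed.

Lemma cp_dual_eval (R : realType) (X : topologicalType) (x : X) :
  @cp_dual R X (fun f => f x).
Proof.
split=> // g Cg e e0; exists [set f | @Cp R X f /\ `|f x - g x| < e].
split=> [|f []//]; split=> [f []//|].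
by exists [set x], e; split=> // f [Cf fg]; split=> //; exact: fg.
Qed.

(** The resolution consists of the polars of the [U a]: they grow as [U a] shrinks, and each whole
    polar is equicontinuous. *)
Lemma G_base_class_G (R : realType) (X : topologicalType) :
  cp_G_base R X -> cp_class_G R X.
Proof.
move=> [U [Unbhs Ubase Umono]].
exists (fun a => [set phi | cp_dual phi /\ forall f, U a f -> `|phi f| <= 1]).
split=> [a phi []//|a b ab phi [dphi Uphi]|phi dphi|a s sA e e0].
- by split=> // f /(Umono _ _ ab); exact: Uphi.
- have [V [V0 phiV]] := dphi.2 _ (@cp_zero R X) 1 ltr01.
  have [a UV] := Ubase _ V0; exists a; split=> // f /UV /phiV.
  by rewrite cp_dual0// subr0 => /ltW.
have [UC [F [d [Ffin d0 FU]]]] := Unbhs a.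
have e2 : 0 < e / 2 by rewrite divr_gt0.
(* Dividing such an [f] by [e / 2] lands in [U a], so the functional is at most [e / 2] at [f]; the
   half gives the strict inequality. *)
exists [set f | @Cp R X f /\ forall x, F x -> `|f x - 0| < e / 2 * d].
split.
  by split=> [f []//|]; exists F, (e / 2 * d); split=> //; rewrite mulr_gt0.
move=> _ f [n _ <-] [Cf Ff]; have [dsn sU] := sA n.
have : `|s n (fun x => (e / 2)^-1 * f x)| <= 1.
  apply: sU; apply: FU; split=> [|x Fx]; first exact: continuous_mull Cf.
  have := Ff x Fx; rewrite !subr0 normrM gtr0_norm ?invr_gt0//.
  by rewrite ltr_pdivrMl.
rewrite cp_dualZ// normrM gtr0_norm ?invr_gt0// ler_pdivrMl// mulr1.
by move=> /le_lt_trans; apply; rewrite ltr_pdivrMr// ltr_pMr// ltr1n.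
Qed.

Lemma class_G_countable (R : realType) (X : topologicalType) :
  tychonoff_sp R X -> cp_class_G R X -> countable [set: X].
Proof.
move=> tX [A [_ Amono Acov Aeq]].
apply: (@countable_finite_resolution X (fun a => [set x | A a (fun f => f x)])).
- move=> a; apply: contrapT => Ainf.
  have [x [xA xN _]] : exists x : nat -> X,
      [/\ forall k, A a (fun f => f (x k)),
          forall j k, (j < k)%N -> x k <> x j & forall k : nat, True].
    have PF := cofinite_proper_filter Ainf.
    have [||x [xA xN _]] := @filter_selection _ _ [set x | A a (fun f => f x)]
        (fun x => ~` [set x]) (fun=> set0) PF.
    + by rewrite /= setDv; exact: finite_set0.
    + move=> x _; apply: (@sub_finite_set _ _ [set x]) => // y [_].
      exact: contrapT.
    by exists x.
  have [V [[_ [F [d [Ffin d0 FV]]]] sV]] := Aeq a (fun n f => f (x n)) xA 1 ltr01.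
  have [n nF] : exists n, ~ F (x n).
    apply: contrapT => /forallNP nF; apply: infinite_nat.
    apply: (@sub_finite_set _ _ (x @^-1` F)) => [n _|]; first exact: contrapT (nF n).
    apply: finite_preimage Ffin => i j _ _ xij.
    by case: (ltngtP i j) => // /xN; rewrite xij.
  have cF : closed F by exact: accessible_finite_set_closed.1 tX.1 _ Ffin.
  (* Since [g] vanishes on [F] it lies in [V], yet evaluation at [x n] gives 1, against
     equicontinuity. *)
  have [g [cg g01 gx gF]] := tychonoff_separation tX cF nF.
  have : `|g (x n)| < 1.
    apply: (sV (fun f => f (x n))); first by exists n.
    apply: FV; split=> // y Fy.
    by rewrite (nbhs_singleton (gF y Fy)) subr0 normr0.
  by rewrite gx normr1 ltxx.
- by move=> a b ab x; exact: Amono.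
- by move=> x; apply: Acov; exact: cp_dual_eval.
Qed.

(** * Constructions over a countable X *)

(** The topology has a countable decreasing base, indexed here by the first coordinate of [a];
    injectivity of [c] makes [c x <= a 0] a condition on finitely many points. *)
Lemma countable_G_base (R : realType) (X : topologicalType) :
  countable [set: X] -> cp_G_base R X.
Proof.
move=> /countable_injP [c cinj].
exists (fun a => [set f | @Cp R X f /\
  forall x, (c x <= a 0)%N -> `|f x| < (a 0).+1%:R^-1]); split.
- move=> a; split=> [f []//|].
  exists (c @^-1` `I_(a 0).+1), (a 0).+1%:R^-1; split=> //.
    by apply: finite_preimage => // x y _ _; apply: cinj; rewrite inE.
  by move=> f [Cf Ff]; split=> // x cx; have := Ff x cx; rewrite subr0.
- move=> V [_ [F [e [Ffin e0 FV]]]].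
  have [N FN] := finite_set_nat_bound c Ffin.
  exists (fun=> maxn N (Num.truncn e^-1)) => f [Cf cf].
  apply: FV; split=> // x Fx; rewrite subr0.
  apply: lt_trans (cf x _) _; first by rewrite leq_max FN.
  rewrite invf_plt ?posrE//; apply: lt_le_trans (truncnS_gt _) _.
  by rewrite ler_nat ltnS leq_maxr.
- move=> a b /(_ 0%N) ab f [Cf cf]; split=> // x cx.
  apply: lt_le_trans (cf x (leq_trans cx ab)) _.
  by rewrite lef_pV2 ?posrE// ler_nat ltnS.
Qed.

(** [B a] is the box whose side at [x] is [a (c x)], and pointwise bounds of a bounded set assemble
    into one such [a]. *)
Lemma countable_fund_bounded_resolution (R : realType) (X : topologicalType) :
  countable [set: X] -> cp_fund_bounded_resolution R X.
Proof.
move=> /countable_injP [c cinj].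
pose B (a : nat -> nat) :=
  [set f | @Cp R X f /\ forall x, `|f x| <= (a (c x))%:R].
have BC a : B a `<=` @Cp R X by move=> f [].
have Bcof D : cp_bounded D -> exists a, D `<=` B a.
  move=> Dbd; have Dm := (cp_boundedP Dbd.1).1 Dbd.
  have /choice [a aP] : forall n, exists m : nat, forall x, c x = n ->
      forall f, D f -> `|f x| <= m%:R.
    move=> n; have [[x cx]|nx] := pselect (exists x, c x = n).
      have [m Dx] := Dm x; exists m => y cy.
      by rewrite (cinj y x) ?inE// cy cx.
    by exists 0%N => x cx; case: nx; exists x.
  by exists a => f Df; split=> [|x]; [exact: Dbd.1|exact: aP].
exists B; split=> //.
- by move=> a; apply/(cp_boundedP (BC a)) => x; exists (a (c x)) => f [].
- by move=> a b ab f [Cf fa]; split=> // x; rewrite (le_trans (fa x))// ler_nat.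
- move=> f Cf; have [|a fB] := Bcof [set f]; last by exists a; exact: fB.
  have fC : [set f] `<=` @Cp R X by move=> _ ->.
  apply/(cp_boundedP fC) => x; exists (Num.truncn `|f x|).+1 => _ ->.
  exact/ltW/truncnS_gt.
Qed.

Theorem theorem4p7 (R : realType) (X : topologicalType) :
  tychonoff_sp R X ->
  (cp_quasiDF R X <-> cp_fund_bounded_resolution R X) /\
  (cp_fund_bounded_resolution R X <-> countable [set: X]) /\
  (countable [set: X] <-> cp_class_G R X) /\
  (cp_class_G R X <-> cp_G_base R X).
Proof.
move=> tX.
have ii_iii := fund_bounded_resolution_countable tX.
have iii_ii := @countable_fund_bounded_resolution R X.
have iii_v := @countable_G_base R X.
have v_iv := @G_base_class_G R X.
have iv_iii := class_G_countable tX.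
(* The cycle (iii), (v), (iv), (iii) together with (ii) iff (iii) suffices, as (i) is by definition
   (ii) and (iv). *)
by rewrite /cp_quasiDF; tauto.
Qed.
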